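(* Let $a\in\mathbb{R}$, $a\ne0$. For every integer $n\ge1$, $$\max_{p\in\mathbb{C}_n[z],\ \|p\|_{[-1,1]}\le1}|p(ai)|=\sqrt{a^2+1}\,\left(|a|+\sqrt{a^2+1}\right)^{n-1},$$ and, for $a>0$, this maximum value is attained by $p=Q_n$.
   Context: $\mathbb{C}_n[z]$ is the space of polynomials in one variable with complex coefficients of degree at most $n$, and $\|p\|_{[-1,1]}=\max_{x\in[-1,1]}|p(x)|$. For $a>0$ the polynomials $Q_n$ are defined by $$Q_1(z)=-\frac{az+i}{\sqrt{a^2+1}},\qquad Q_2(z)=\frac{1}{\sqrt{a^2+1}}\left(-(a+\sqrt{a^2+1})z^2-iz+\sqrt{a^2+1}\right),$$ $$Q_{n+1}(z)=2zQ_n(z)-Q_{n-1}(z),\quad n\ge2.$$ *)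

(* Defs.v *)
From HB Require Import structures.
From mathcomp Require Import all_boot all_order all_algebra.
From mathcomp Require Import complex.
From mathcomp Require Import all_classical all_reals all_analysis.

Set Implicit Arguments.
Unset Strict Implicit.
Unset Printing Implicit Defensive.

Import Order.TTheory GRing.Theory Num.Theory.
Import numFieldTopology.Exports numFieldNormedType.Exports.

Local Open Scope classical_set_scope.
Local Open Scope ring_scope.
Local Open Scope complex_scope.

Definition is_max (R : realType) (A : set R) (m : R) : Prop :=
  A m /\ ubound A m.

Definition abs_values (R : realType) (p : {poly R[i]}) : set R :=
  [set Normc.normc p.[x%:C] | x in `[(-1 : R), 1]].

(* [sup] is 0 by convention on unbounded sets; [supnorm_is_max] shows that this
   case does not occur and that the supremum is a maximum. *)
Definition supnorm (R : realType) (p : {poly R[i]}) : R := sup (abs_values p).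

(* Recall that [size p] is the degree of [p] plus one when [p != 0]. *)
Definition deg_le (R : realType) (n : nat) (p : {poly R[i]}) : Prop :=
  (size p <= n.+1)%N.

Definition admissible (R : realType) (n : nat) : set {poly R[i]} :=
  [set p | deg_le n p /\ supnorm p <= 1].

(* The polynomials are indexed from 1; the value at index 0 is a dummy, which
   the recurrence (used from index 3 on) never reads. *)
Fixpoint Q (R : realType) (a : R) (n : nat) {struct n} : {poly R[i]} :=
  let s := Num.sqrt (a ^+ 2 + 1) in
  match n with
  | 0 => 0
  | 1 => - ((s^-1)%:C *: (a%:C *: 'X + ('i%C)%:P))
  | 2 => (s^-1)%:C *: (- ((a + s)%:C *: 'X^2) - 'i%C *: 'X + (s%:C)%:P)
  | (k.+1 as m).+1 => 2%:R *: ('X * Q a m) - Q a k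
  end.

Lemma horner_realC (R : realType) (p : {poly R[i]}) (x : R) :
  p.[x%:C] = (map_poly (@complex.Re R) p).[x] +i* (map_poly (@complex.Im R) p).[x].
Proof.
elim/poly_ind: p => [|p c IH]; first by rewrite !map_poly0 !horner0.
have E (f : {additive R[i] -> R}) :
    (map_poly f (p * 'X + c%:P)).[x] = (map_poly f p).[x] * x + f c.
  have -> : map_poly f (p * 'X + c%:P) = map_poly f p * 'X + (f c)%:P.
    apply/polyP => i; rewrite coef_map !coefD !coefMX !coefC raddfD /= coef_map.
    by case: i => [|i] /=; rewrite ?raddf0.
  by rewrite !hornerE.
rewrite (E (@complex.Re R)) (E (@complex.Im R)) !hornerE IH.
by case: c {E} => c d; apply/eqP; rewrite eq_complex /= !mulr0 subr0 add0r !eqxx.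
Qed.

Lemma supnorm_is_max (R : realType) (p : {poly R[i]}) :
  is_max (abs_values p) (supnorm p).
Proof.
set f := fun x : R => Normc.normc p.[x%:C].
have cf : continuous f.
  pose u := map_poly (@complex.Re R) p; pose v := map_poly (@complex.Im R) p.
  have -> : f = fun x => Num.sqrt ((u * u + v * v).[x]).
    by apply/funext => x; rewrite /f horner_realC /= !hornerE !expr2.
  move=> x; apply: (@continuous_comp _ _ _ (horner (u * u + v * v)) Num.sqrt).
    exact: continuous_horner.
  exact: sqrt_continuous.
have le11 : (-1 : R) <= 1 by rewrite (le_trans (lerN10 R)) ?ler01.
have [c cI cmax] := EVT_max le11 (continuous_subspaceT cf).
have fcA : abs_values p (f c) by exists c; rewrite //= cI.
have fcU : ubound (abs_values p) (f c).
  by move=> _ [x /= xI <-]; apply: cmax.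
have -> : supnorm p = f c.
  apply/le_anti/andP; split; first by apply: ge_sup => //; exists (f c).
  by apply: ub_le_sup => //; exists (f c).
by split.
Qed.

(* Main.v *)
(* Take a > 0, s = sqrt(a^2+1), b = s - a = 1/(a+s), x = cos t, u = exp(it), v = 1/u.
   Solving the recurrence gives
     4s Q_n(x) = -(a+s) [u^n (1+ibv)^2 + v^n (1+ibu)^2],
   whence |Q_n| <= 1 on [-1,1], and the value at x = ai comes from u = i(a+s).
   Put k(t) = u^n (1 + b^2 v^2).  By the intermediate value theorem k is real at
   n+1 points t_0 < ... < t_n of [0,pi], with sign (-1)^j at t_j; there
   k Q_n(x) = -2ib (x - ai) and |Q_n(x)| = 1.
   If p were admissible with |p(ai)| > |Q_n(ai)|, put w = Q_n(ai)/p(ai) and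
   Q_n - w p = (x - ai) r.  Since |w p| < 1 = |Q_n| at the nodes, k Im r < 0 there,
   so the real polynomial Im r, of degree < n, changes sign n times: contradiction. *)
Require Import Defs.
From mathcomp Require Import all_boot all_order all_algebra.
From mathcomp Require Import complex polyrcf.
From mathcomp Require Import all_classical all_reals all_analysis.
From mathcomp Require Import ring lra.

Set Implicit Arguments.
Unset Strict Implicit.

Import Order.TTheory GRing.Theory Num.Theory.
Import numFieldTopology.Exports numFieldNormedType.Exports.

Local Open Scope classical_set_scope.
Local Open Scope ring_scope.
Local Open Scope complex_scope.

(** * Real polynomials with many sign changes *)

(** By the intermediate value theorem each of the n gaps between consecutive nodes holds a root; the
    gaps are disjoint, so a nonzero [h] would have n distinct roots and degree below n. The nodes
    decrease because they will be cosines of increasing angles. *)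
Lemma sign_changes_poly_eq0 (R : rcfType) (h : {poly R}) (n : nat) (x : nat -> R) :
  (size h <= n)%N ->
  (forall i j, (i < j <= n)%N -> x j < x i) ->
  (forall j, (j < n)%N -> h.[x j.+1] * h.[x j] < 0) -> h = 0.
Proof.
move=> sh xdecr hsign; apply/eqP; case: eqP => // /eqP h0.
have xdecrS j : (j < n)%N -> x j.+1 < x j by move=> jn; apply: xdecr; rewrite ltnSn.
have /choice [y yP] : forall j, exists z, (j < n)%N -> x j.+1 < z < x j /\ root h z.
  move=> j; case: (ltnP j n) => jn; last by exists 0.
  have [z zI rz] := poly_ivtoo (ltW (xdecrS j jn)) (hsign j jn).
  by exists z => _; split=> //; rewrite in_itv /= in zI.
have ydecr i j : (i < j)%N -> (j < n)%N -> y j < y i.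
  move=> ij jn; have [/andP[_ yj] _] := yP j jn.
  have [/andP[yi _] _] := yP i (ltn_trans ij jn).
  apply: lt_trans yj (le_lt_trans _ yi).
  move: ij; rewrite leq_eqVlt => /orP[/eqP <- //|ij].
  by apply/ltW/xdecr; rewrite ij ltnW.
have := @max_poly_roots _ h (mkseq y n) h0.
rewrite size_mkseq ltnNge sh => H; suff: false by []; apply: H.
  by apply/allP => _ /mapP[j + ->]; rewrite mem_iota => /= jn; have [] := yP j jn.
rewrite map_inj_in_uniq ?iota_uniq // => i j; rewrite !mem_iota /= => ni nj yij.
case: (ltngtP i j) => [ij|ji|//].
  by have := ydecr i j ij nj; rewrite yij ltxx.
by have := ydecr j i ji ni; rewrite yij ltxx.
Qed.

(** * Angles at which u^n (1 + c v^2) is real *)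

Lemma sinDn (R : realType) (x : R) j : sin (x + pi *+ j) = (-1) ^+ j * sin x.
Proof. exact: (alternatingn (@sinDpi R)). Qed.

Lemma cosDn (R : realType) (x : R) j : cos (x + pi *+ j) = (-1) ^+ j * cos x.
Proof. exact: (alternatingn (@cosDpi R)). Qed.

(** For [c] = b^2 the equation says that k(t) is real. Zeros come from sign changes of the imaginary
    part between points where sin(nt) is 1 or -1, together with the endpoints 0 and pi. The window
    about pi j serves to order the nodes and to fix the sign of k there. *)
Lemma phase_nodes (R : realType) (c : R) (n : nat) : (0 < n)%N -> 0 < c < 1 ->
  exists t : nat -> R, forall j, (j <= n)%N ->
    [/\ 0 <= t j <= pi,
        - (pi / 2) < n%:R * t j - pi *+ j < pi / 2
      & sin (n%:R * t j) + c * sin (n%:R * t j - 2 * t j) = 0].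
Proof.
move=> n0 /andP[c0 c1]; set g := fun t : R => sin (n%:R * t) + c * sin (n%:R * t - 2 * t).
have nR : 0 < n%:R :> R by rewrite ltr0n.
have p0 := pi_gt0 R.
pose tau j : R := (pi / 2 + pi *+ j) / n%:R.
have ntau j : n%:R * tau j = pi / 2 + pi *+ j by rewrite /tau mulrC divfK ?gt_eqF.
have gtau j : 0 < (-1) ^+ j * g (tau j).
  rewrite /g ntau [_ - 2 * _]addrAC !sinDn sin_pihalf.
  (* The first term of [g] is (-1)^j here, and [c] < 1 keeps the second from cancelling it. *)
  have := sin_geN1 (pi / 2 - 2 * tau j); set S := sin _ => S1.
  rewrite (_ : _ * _ = ((-1) ^+ j) ^+ 2 * (1 + c * S)); last by ring.
  have : 0 <= c * (S + 1) by apply: mulr_ge0; lra.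
  by rewrite sqrr_sign mul1r mulrDr mulr1; lra.
have cg : continuous g.
  move=> t; apply: cvgD; first by
    apply: (@continuous_comp _ _ _ (fun t : R => n%:R * t) sin);
    [exact: cvgMr|exact: continuous_sin].
  apply: cvgMr; apply: (@continuous_comp _ _ _ (fun t : R => n%:R * t - 2 * t) sin);
    last exact: continuous_sin.
  by apply: cvgB; apply: cvgMr.
suff /choice[t tP] : forall j, exists t : R, (j <= n)%N ->
    [/\ 0 <= t <= pi, - (pi / 2) < n%:R * t - pi *+ j < pi / 2 & g t = 0] by exists t.
move=> j.
case: (posnP j) => [->|j0].
  exists 0 => _; split; first lra.
    by rewrite mulr0 mulr0n subr0; lra.
  by rewrite /g !mulr0 subr0 sin0 mulr0 addr0.
case: (ltngtP j n) => [jn|jn|->]; last first.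
- exists pi => _; split; first lra.
  + by rewrite mulr_natl subrr; lra.
  + rewrite /g mulr_natl (_ : pi *+ n - _ = - (pi *+ 2) + pi *+ n); last by rewrite mulr_natl addrC.
    by rewrite -[pi *+ n in X in X + _]add0r !sinDn sinN sin0 sin2pi; ring.
(* Indices above n are unconstrained; 0 is a filler. *)
- by exists 0; lra.
(* An interior index is written j+1, so its zero lies between [tau j] and [tau j.+1]. *)
case: j j0 jn => // j _ jn.
have le_tau : tau j <= tau j.+1.
  by rewrite /tau ler_pM2r ?invr_gt0 // lerD2l ler_wpMn2l ?ltW.
have gj := gtau j; have gj1 := gtau j.+1.
have [t tI gt] : exists2 t, t \in `[tau j, tau j.+1] & g t = 0.
  apply: IVT => //; first exact: continuous_subspaceT.
  move: gj gj1; rewrite exprS mulN1r ge_min le_max -signr_odd.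
  case: (odd j) => /=; rewrite ?expr1 ?expr0 ?mulN1r ?opprK ?mul1r ?mulN1r => h1 h2.
    by apply/andP; split; apply/orP; [left|right]; lra.
  by apply/andP; split; apply/orP; [right|left]; lra.
rewrite in_itv /= in tI; case/andP: tI => t1 t2.
have {}t1 : tau j < t.
  by rewrite lt_neqAle t1 andbT; apply/eqP => E; rewrite E gt mulr0 ltxx in gj.
have {}t2 : t < tau j.+1.
  by rewrite lt_neqAle t2 andbT; apply/eqP => E; rewrite -E gt mulr0 ltxx in gj1.
have tau0 : 0 <= tau j.
  apply: divr_ge0 (ltW nR); apply: addr_ge0; first lra.
  by rewrite mulrn_wge0 // ltW.
exists t => _; split; last exact: gt.
- apply/andP; split; first by rewrite (le_trans tau0) // ltW.
  apply: (le_trans (ltW t2)); rewrite /tau ler_pdivrMr // mulr_natr.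
  apply: (@le_trans _ _ (pi *+ j.+2)); last by rewrite ler_wpMn2l // ltW.
  by rewrite (mulrS pi j.+1) lerD2r; lra.
- have : n%:R * tau j < n%:R * t by rewrite ltr_pM2l.
  have : n%:R * t < n%:R * tau j.+1 by rewrite ltr_pM2l.
  by rewrite !ntau !(mulrS pi); lra.
Qed.

(** * Modulus of complex numbers and points of the unit circle *)

Section ComplexModulus.
Variable R : rcfType.
Implicit Types z w : R[i].

Lemma normcE2 z : Normc.normc z ^+ 2 = complex.Re z ^+ 2 + complex.Im z ^+ 2.
Proof. by case: z => x y /=; rewrite sqr_sqrtr // addr_ge0 ?sqr_ge0. Qed.

Lemma normc_ge0 z : 0 <= Normc.normc z.
Proof. by case: z => x y; apply: sqrtr_ge0. Qed.

Lemma normcX z n : Normc.normc (z ^+ n) = Normc.normc z ^+ n.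
Proof.
by elim: n => [|n IH]; rewrite ?Normc.normc1 // !exprS Normc.normcM IH.
Qed.

Lemma normc_real (x : R) : 0 <= x -> Normc.normc x%:C = x.
Proof. by move=> x0; rewrite /= expr0n addr0 sqrtr_sqr ger0_norm. Qed.

End ComplexModulus.

Definition cis {R : realType} (t : R) : R[i] := cos t +i* sin t.

Lemma cisD (R : realType) (x y : R) : cis (x + y) = cis x * cis y.
Proof.
by apply/eqP; rewrite /cis cosD sinD eq_complex /= [sin x * _ + _]addrC !eqxx.
Qed.

Lemma cis0 (R : realType) : cis (0 : R) = 1.
Proof. by rewrite /cis cos0 sin0. Qed.

Lemma cisX (R : realType) (t : R) n : cis t ^+ n = cis (n%:R * t).
Proof.
elim: n => [|n IH]; first by rewrite mul0r cis0.
by rewrite exprS IH -cisD -natr1 mulrDl mul1r addrC.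
Qed.

(** * Closed form, bound and special value of Q_n for a > 0 *)

Section PositiveParameter.
Variables (R : realType) (a : R).
Hypothesis a_gt0 : 0 < a.

Let s : R := Num.sqrt (a ^+ 2 + 1).
Let b : R := s - a.

Local Lemma s_sqr : s ^+ 2 = a ^+ 2 + 1.
Proof. by rewrite sqr_sqrtr // addr_ge0 ?sqr_ge0. Qed.

Local Lemma s_gt0 : 0 < s.
Proof. by rewrite sqrtr_gt0 ltr_wpDl ?sqr_ge0. Qed.

Local Lemma b_bounds : 0 < b < 1.
Proof.
have a0 := a_gt0; have s0 := s_gt0; have e := s_sqr; rewrite /b subr_gt0 ltrBlDr.
apply/andP; split; rewrite -(ltr_pXn2r (n := 2)) ?nnegrE ?e ?sqrrD ?expr1n //; lra.
Qed.

Local Lemma mul_rho_b : (a + s) * b = 1.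
Proof. by rewrite /b; ring: s_sqr. Qed.

Local Lemma Q_rec (k : nat) (x : R[i]) :
  (Q a k.+3).[x] = 2 * x * (Q a k.+2).[x] - (Q a k.+1).[x].
Proof.
change (Q a k.+3) with (2%:R *: ('X * Q a k.+2) - Q a k.+1).
by rewrite !hornerE.
Qed.

Local Lemma real_complexM4s (x y : R[i]) : 4 * s%:C * x = 4 * s%:C * y -> x = y.
Proof.
apply: mulfI; rewrite mulf_eq0 negb_or pnatr_eq0 /=.
by apply/eqP => /complexI/eqP; rewrite gt_eqF ?s_gt0.
Qed.

(** Both sides satisfy f_(n+1) = (u + v) f_n - f_(n-1), because u v = 1, and they agree for n = 1,
    2. Keeping u and v arbitrary lets the formula serve both on the unit circle and at the point
    ai. *)
Local Lemma Q_joukowski (n : nat) (x u v : R[i]) :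
  (0 < n)%N -> u * v = 1 -> u + v = 2 * x ->
  4 * s%:C * (Q a n).[x] =
  - (a + s)%:C * (u ^+ n * (1 + 'i%C * b%:C * v) ^+ 2
                  + v ^+ n * (1 + 'i%C * b%:C * u) ^+ 2).
Proof.
move=> n0 uv xE.
have i2 : 'i%C ^+ 2 = -1 :> R[i] by exact: sqr_i.
have s2 : s%:C ^+ 2 = a%:C ^+ 2 + 1 :> R[i] by rewrite -!rmorphXn /= s_sqr rmorphD rmorph1.
have ss : s%:C * (s^-1)%:C = 1 :> R[i].
  by rewrite -rmorphM /= divff ?rmorph1 // gt_eqF // s_gt0.
have bE : b%:C = s%:C - a%:C :> R[i] by rewrite rmorphB.
rewrite bE rmorphD /=; clear bE.
have Q1 : 4 * s%:C * (Q a 1).[x] = - (2 * a%:C * (u + v) + 4 * 'i%C).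
  by rewrite [Q a 1]/= !hornerE -/s xE; ring: ss.
have Q2 : 4 * s%:C * (Q a 2).[x] =
    - (a%:C + s%:C) * (u + v) ^+ 2 - 2 * 'i%C * (u + v) + 4 * s%:C.
  by rewrite [Q a 2]/= !hornerE -/s xE rmorphD /=; ring: ss.
elim/ltn_ind: n n0 => -[|[|[|k]]] // IH _.
- rewrite Q1. ring: uv i2 s2.
- rewrite Q2. ring: uv i2 s2.
- rewrite Q_rec mulrBr (IH k.+1) // mulrCA (IH k.+2) // -xE.
  rewrite !exprS. ring: uv.
Qed.

Local Lemma size_Q n : (size (Q a n) <= n.+1)%N.
Proof.
elim/ltn_ind: n => -[|[|[|k]]] IH.
- by rewrite size_poly0.
- rewrite [Q a 1]/= size_polyN (leq_trans (size_scale_leq _ _)) //.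
  rewrite (leq_trans (size_polyD _ _)) // geq_max (leq_trans (size_scale_leq _ _)) ?size_polyX //=.
  exact: leq_trans (size_polyC_leq1 _) _.
- rewrite [Q a 2]/= (leq_trans (size_scale_leq _ _)) //.
  rewrite (leq_trans (size_polyD _ _)) // geq_max (leq_trans (size_polyC_leq1 _)) // andbT.
  rewrite (leq_trans (size_polyD _ _)) // geq_max !size_polyN.
  by rewrite !(leq_trans (size_scale_leq _ _)) ?size_polyX ?size_polyXn.
- change (Q a k.+3) with (2%:R *: ('X * Q a k.+2) - Q a k.+1).
  rewrite (leq_trans (size_polyD _ _)) // geq_max size_polyN.
  apply/andP; split; last by apply: leq_trans (IH k.+1 _) _; rewrite // ltnS ltnW.
  apply: leq_trans (size_scale_leq _ _) _; apply: leq_trans (size_polyMleq _ _) _.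
  by rewrite size_polyX; apply: (IH k.+2).
Qed.

(** On the unit circle v is the conjugate of u, so the triangle inequality leaves |1 + ibv|^2 + |1 +
    ibu|^2 = 2 + 2b^2, the linear terms cancelling. Then (a+s)(1 + b^2) = (a+s) + b = 2s turns the
    bound into 4s. *)
Local Lemma normc_Q_le1 n (x : R) : (0 < n)%N -> -1 <= x <= 1 ->
  Normc.normc (Q a n).[x%:C] <= 1.
Proof.
move=> n0 /andP[x1 x2]; have s0 := s_gt0; have rb := mul_rho_b; have a0 := a_gt0.
pose y := Num.sqrt (1 - x ^+ 2).
have y2 : x ^+ 2 + y ^+ 2 = 1.
  rewrite sqr_sqrtr; first by ring.
  have : 0 <= (1 - x) * (1 + x) by apply: mulr_ge0; lra.
  by rewrite (_ : _ * _ = 1 - x ^+ 2) //; ring.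
have y2' : y ^+ 2 = 1 - x ^+ 2 by rewrite -y2; ring.
pose u : R[i] := x +i* y; pose v : R[i] := x -i* y.
have uv : u * v = 1.
  apply/eqP; rewrite eq_complex /= mulrN opprK -!expr2 y2.
  by apply/andP; split; apply/eqP; ring.
have uDv : u + v = 2 * x%:C.
  by apply/eqP; rewrite eq_complex /=; apply/andP; split; apply/eqP; ring.
have nu : Normc.normc u = 1 by rewrite /= y2 sqrtr1.
have nv : Normc.normc v = 1 by rewrite /= sqrrN y2 sqrtr1.
have := congr1 (@Normc.normc R) (Q_joukowski n0 uv uDv).
have nr (r : R) : 0 <= r -> Normc.normc r%:C = r by exact: normc_real.
rewrite -(rmorph_nat (real_complex R) 4) mulNr normcN !Normc.normcM.
rewrite !nr ?(ltW (addr_gt0 a0 s0)) ?(ltW s0) //.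
move=> E; have : Normc.normc (u ^+ n * (1 + 'i%C * b%:C * v) ^+ 2
                  + v ^+ n * (1 + 'i%C * b%:C * u) ^+ 2) <= 2 + 2 * b ^+ 2.
  apply: le_trans (le_normcD _ _) _.
  rewrite (Normc.normcM (u ^+ n)) (Normc.normcM (v ^+ n)) !normcX nu nv.
  rewrite !expr1n !mul1r !normcE2 /= le_eqVlt.
  by apply/orP; left; apply/eqP; ring: y2'.
rewrite -(ler_pM2l (x := a + s)) ?addr_gt0 // -E.
rewrite (_ : (a + s) * (2 + _) = 4 * s * 1); last by rewrite /b; ring: s_sqr.
by rewrite ler_pM2l // mulr_gt0.
Qed.

Local Lemma normc_Q_value n : (0 < n)%N ->
  Normc.normc (Q a n).[a%:C * 'i%C] = s * (a + s) ^+ (n - 1).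
Proof.
move=> n0; have s0 := s_gt0; have rb := mul_rho_b; have a0 := a_gt0.
(* These solve u + v = 2ai, u v = 1. Since b(a+s) = 1, the factor 1 + ibu vanishes and only the u^n
   term survives. *)
pose u : R[i] := 0 +i* (a + s); pose v : R[i] := 0 -i* b.
have uv : u * v = 1.
  apply/eqP; rewrite eq_complex /= mulrN opprK rb.
  by apply/andP; split; apply/eqP; ring.
have uDv : u + v = 2 * (a%:C * 'i%C).
  by apply/eqP; rewrite eq_complex /= /b; apply/andP; split; apply/eqP; ring.
have := congr1 (@Normc.normc R) (Q_joukowski n0 uv uDv).
have -> : 1 + 'i%C * b%:C * u = 0.
  by apply/eqP; rewrite eq_complex /=; apply/andP; split; apply/eqP; rewrite /b; ring: s_sqr.
have -> : 1 + 'i%C * b%:C * v = (1 + b ^+ 2)%:C.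
  by apply/eqP; rewrite eq_complex /=; apply/andP; split; apply/eqP; ring.
have nr (r : R) : 0 <= r -> Normc.normc r%:C = r by exact: normc_real.
rewrite -(rmorph_nat (real_complex R) 4) mulNr normcN expr0n mulr0 addr0 !Normc.normcM !normcX.
rewrite !nr ?(ltW s0) ?(ltW (addr_gt0 a0 s0)) ?addr_ge0 ?sqr_ge0 //.
have -> : Normc.normc u = a + s.
  by rewrite /= expr0n add0r sqrtr_sqr ger0_norm // ltW // addr_gt0.
move=> E; have s4 : 4 * s != 0 by rewrite gt_eqF // mulr_gt0.
apply: (mulfI s4); rewrite E.
case: n n0 {E} => // n _; rewrite subn1 /= (exprS (a + s)).
have e : (a + s) * (1 + b ^+ 2) = 2 * s by rewrite /b; ring: s_sqr.
rewrite [LHS](_ : _ = ((a + s) * (1 + b ^+ 2)) ^+ 2 * (a + s) ^+ n); last by ring.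
by rewrite e; ring.
Qed.

(** * The extremal polynomial at the nodes *)

(** Being real, u^n (1 + b^2 v^2) equals its conjugate, so u^n k = 1 + b^2 u^2 and v^n k = 1 + b^2
    v^2. These relations remove the powers n from k^2 and from the closed form. The two conclusions
    together give |Q_n| = 1 at the node. *)
Local Lemma node_extremal n (t : R) : (0 < n)%N ->
  let k := cos (n%:R * t) + b ^+ 2 * cos (n%:R * t - 2 * t) in
  sin (n%:R * t) + b ^+ 2 * sin (n%:R * t - 2 * t) = 0 ->
  k ^+ 2 = 4 * b ^+ 2 * (cos t ^+ 2 + a ^+ 2) /\
  k%:C * (Q a n).[(cos t)%:C]
    = - (2 * 'i%C * b%:C * ((cos t)%:C - a%:C * 'i%C)).
Proof.
move=> n0 k knode; set x := cos t.
pose u := cis t; pose v := cis (- t).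
have uv : u * v = 1 by rewrite -cisD subrr cis0.
have uDv : u + v = 2 * x%:C.
  by apply/eqP; rewrite eq_complex /= cosN sinN; apply/andP; split; apply/eqP; rewrite -/x; ring.
have kE : k%:C = cis (n%:R * t) + b%:C ^+ 2 * cis (n%:R * t - 2 * t).
  by rewrite -rmorphXn; apply/eqP; rewrite eq_complex /= /k !mul0r subr0 addr0 knode !eqxx.
have kE' : k%:C = cis (- (n%:R * t)) + b%:C ^+ 2 * cis (- (n%:R * t - 2 * t)).
  rewrite -rmorphXn; apply/eqP; rewrite eq_complex /= /k !mul0r subr0 addr0 !cosN !sinN.
  by rewrite mulrN -opprD knode oppr0 !eqxx.
have uvn : u ^+ n * v ^+ n = 1 by rewrite -exprMn uv expr1n.
have {}kE : k%:C = u ^+ n * (1 + b%:C ^+ 2 * v ^+ 2).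
  by rewrite kE mulrDr mulr1 mulrCA !cisX -cisD mulrN.
have {}kE' : k%:C = v ^+ n * (1 + b%:C ^+ 2 * u ^+ 2).
  by rewrite kE' mulrDr mulr1 mulrCA !cisX -cisD mulrN opprD opprK.
clearbody k.
have uk : u ^+ n * k%:C = 1 + b%:C ^+ 2 * u ^+ 2 by rewrite kE' mulrA uvn mul1r.
have vk : v ^+ n * k%:C = 1 + b%:C ^+ 2 * v ^+ 2.
  by rewrite kE mulrA [v ^+ n * _]mulrC uvn mul1r.
have i2 : 'i%C ^+ 2 = -1 :> R[i] by exact: sqr_i.
have s2 : s%:C ^+ 2 = a%:C ^+ 2 + 1 :> R[i] by rewrite -!rmorphXn /= s_sqr rmorphD rmorph1.
have bE : b%:C = s%:C - a%:C :> R[i] by rewrite rmorphB.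
(* Eliminating v and reducing by the quadratic equation of u brings both claims within reach of
   [ring]. *)
have vE : v = 2 * x%:C - u by rewrite -uDv; ring.
have u2 : u ^+ 2 = 2 * x%:C * u - 1 by rewrite -uDv -uv; ring.
split.
  apply: complexI; rewrite !(rmorphM, rmorphD, rmorphXn, rmorph_nat) /=.
  have -> : k%:C * k%:C = (1 + b%:C ^+ 2 * v ^+ 2) * (1 + b%:C ^+ 2 * u ^+ 2).
    by rewrite {1}kE mulrAC uk mulrC.
  rewrite bE; rewrite vE.
  by ring: u2 s2.
apply: real_complexM4s; rewrite mulrCA (Q_joukowski n0 uv uDv).
rewrite [LHS](_ : _ = - (a + s)%:C * ((u ^+ n * k%:C) * (1 + 'i%C * b%:C * v) ^+ 2
   + (v ^+ n * k%:C) * (1 + 'i%C * b%:C * u) ^+ 2)); last by ring.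
rewrite uk vk rmorphD /= bE; rewrite vE.
by ring: u2 s2 i2.
Qed.

(** Put T = nt - pi j and z = 1 + b^2 exp(-2it). Then exp(iT) z is the real number K = (-1)^j k, so
    cos T = K Re z / |z|^2; here cos T > 0 by the window and Re z > 0 by b < 1. *)
Local Lemma node_sign n j (t : R) :
  let k := cos (n%:R * t) + b ^+ 2 * cos (n%:R * t - 2 * t) in
  sin (n%:R * t) + b ^+ 2 * sin (n%:R * t - 2 * t) = 0 ->
  - (pi / 2) < n%:R * t - pi *+ j < pi / 2 -> 0 < (-1) ^+ j * k.
Proof.
rewrite /= => knode /cos_gt0_pihalf; move: knode.
have -> : n%:R * t = (n%:R * t - pi *+ j) + pi *+ j by rewrite subrK.
set T := n%:R * t - _; clearbody T; rewrite [_ - 2 * t]addrAC !sinDn !cosDn addrK (cosB T) (sinB T).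
set C := cos T; set S := sin T; set c := cos _; set d := sin _ => knode C0.
have {}knode : S + b ^+ 2 * (S * c - C * d) = 0.
  apply/eqP; have /eqP := knode; rewrite mulrCA -mulrDr mulf_eq0.
  by rewrite signr_eq0.
rewrite [ltRHS](_ : _ = C + b ^+ 2 * (C * c + S * d)); last first.
  by rewrite (mulrCA (b ^+ 2)) -mulrDr mulrA -expr2 sqrr_sign mul1r.
have /andP[b0 b1] := b_bounds.
have cd : 0 < 1 + b ^+ 2 * c.
  have b2 : 0 < b ^+ 2 < 1 by rewrite exprn_gt0 // expr_lt1 // ltW.
  have : 0 <= b ^+ 2 * (c + 1).
    by rewrite mulr_ge0 ?sqr_ge0 // -lerBlDr sub0r cos_geN1.
  by rewrite mulrDr mulr1; lra.
(* Multiplying by Re z gives cos T |z|^2 plus a multiple of the vanishing imaginary part. *)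
rewrite -(pmulr_lgt0 _ cd).
rewrite [ltRHS](_ : _ = C * ((1 + b ^+ 2 * c) ^+ 2 + (b ^+ 2 * d) ^+ 2)
    + b ^+ 2 * d * (S + b ^+ 2 * (S * c - C * d))); last by ring.
by rewrite knode mulr0 addr0 mulr_gt0 // ltr_pwDl ?exprn_gt0 ?sqr_ge0.
Qed.

(** * Comparison of Q_n with a competitor *)

Local Lemma extremal_bound n (p : {poly R[i]}) : (0 < n)%N -> (size p <= n.+1)%N ->
  (forall x : R, -1 <= x <= 1 -> Normc.normc p.[x%:C] <= 1) ->
  Normc.normc p.[a%:C * 'i%C] <= Normc.normc (Q a n).[a%:C * 'i%C].
Proof.
move=> n0 szp p1; rewrite leNgt; apply/negP => ltQp.
set c := a%:C * 'i%C in ltQp *.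
have a0 := a_gt0; have /andP[b0 b1] := b_bounds.
have Qc_gt0 : 0 < Normc.normc (Q a n).[c].
  by rewrite normc_Q_value // mulr_gt0 ?exprn_gt0 ?addr_gt0 ?s_gt0.
have pc_gt0 := lt_trans Qc_gt0 ltQp.
have pc0 : p.[c] != 0.
  by apply/eqP => pc; move: pc_gt0; rewrite pc Normc.normc0 ltxx.
pose w := (Q a n).[c] / p.[c].
have nw : Normc.normc w < 1.
  by rewrite Normc.normcM Normc.normcV ltr_pdivrMr // mul1r.
have /factor_theorem[r qE] : root (Q a n - w *: p) c.
  by rewrite rootE !hornerE divfK // subrr.
have szr : (size r <= n)%N.
  have [->|r0] := eqVneq r 0; first by rewrite size_poly0.
  have := congr1 (fun q : {poly R[i]} => size q) qE.
  rewrite size_Mmonic ?monicXsubC // size_XsubC addn2 /= => szq.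
  rewrite -ltnS -szq (leq_trans (size_polyD _ _)) // geq_max size_Q size_polyN.
  exact: leq_trans (size_scale_leq _ _) szp.
(* On the real line [h] takes the values Im r(x), by [horner_realC]. *)
pose h := map_poly (@complex.Im R) r.
have szh : (size h <= n)%N by apply: leq_trans (size_poly _ _) szr.
have b2 : 0 < b ^+ 2 < 1 by rewrite exprn_gt0 // expr_lt1 // ltW.
have [t tP] := phase_nodes n0 b2.
have hsign j : (j <= n)%N -> (-1) ^+ j * h.[cos (t j)] < 0.
  move=> jn; have [tI twin tnode] := tP j jn.
  have := node_sign tnode twin; have [] := node_extremal n0 tnode.
  set k := _ + _; clearbody k; set x := cos (t j) => k2 kQ ksgn.
  have x1 : -1 <= x <= 1 by rewrite cos_geN1 cos_le1.
  have px := p1 x x1.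
  have := horner_realC r x; rewrite -/h; set u := (map_poly _ r).[x]; set v := h.[x] => rx.
  have := congr1 (fun q => k%:C * q.[x%:C]) qE.
  rewrite hornerM hornerXsubC hornerD hornerN hornerZ mulrBr kQ rx => E.
  (* The node value of k Q_n has the factor x - c, so x - c can be pulled out of k w p as well. In
     squared moduli, |x - c|^2 = x^2 + a^2 then cancels against k^2. *)
  have {}E : k%:C * (w * p.[x%:C]) = - ((x%:C - c) * (2 * 'i%C * b%:C + k%:C * (u +i* v))).
    by rewrite /c -[LHS](subKr (- (2 * 'i%C * b%:C * (x%:C - a%:C * 'i%C)))) E /c; ring.
  have := congr1 (@Normc.normc R) E.
  rewrite normcN (Normc.normcM k%:C) (Normc.normcM w) (Normc.normcM (x%:C - c)).
  set m := Normc.normc w * _.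
  have m1 : 0 <= m < 1.
    apply/andP; split; first by rewrite mulr_ge0 ?normc_ge0.
    by apply: le_lt_trans nw; rewrite ler_piMr ?normc_ge0.
  clearbody m.
  have X0 : 0 < x ^+ 2 + a ^+ 2 by rewrite ltr_wpDl ?sqr_ge0 ?exprn_gt0.
  move=> /(congr1 (fun y => y ^+ 2)); rewrite exprMn [RHS]exprMn !normcE2 /c /= => H.
  have {}H : 4 * b ^+ 2 * m ^+ 2 = (k * u) ^+ 2 + (2 * b + k * v) ^+ 2.
    apply: (mulfI (lt0r_neq0 X0)); rewrite mulrA [_ * (4 * _)]mulrC -k2.
    by transitivity ((k ^+ 2 + 0 ^+ 2) * m ^+ 2); [ring | rewrite H; ring].
  have m2 : m ^+ 2 < 1 by rewrite expr_lt1 //; lra.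
  (* Since m < 1, expanding gives (ku)^2 + 4b kv + (kv)^2 < 0, which forces kv < 0. *)
  have kv : k * v < 0.
    have b20 : 0 < b ^+ 2 by lra.
    have : 4 * b ^+ 2 * m ^+ 2 < 4 * b ^+ 2 * 1 by rewrite ltr_pM2l //; lra.
    have U := sqr_ge0 (k * u); have V := sqr_ge0 (k * v).
    rewrite H sqrrD => H2; rewrite -(pmulr_rlt0 _ b0); lra.
  have e : ((-1) ^+ j * k) * ((-1) ^+ j * v) = k * v.
    by rewrite mulrACA -expr2 sqrr_sign mul1r.
  by rewrite -(pmulr_rlt0 _ ksgn) e.
have h0 : h = 0.
  apply: (@sign_changes_poly_eq0 _ h n (fun j => cos (t j))) => // [i j /andP[ij jn]|j jn].
    have [ti wi _] := tP i (ltnW (leq_trans ij jn)); have [tj wj _] := tP j jn.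
    rewrite ltr_cos // ?in_itv //= -(ltr_pM2l (x := n%:R)) ?ltr0n //.
    (* The windows of half-width pi/2 about pi i and pi j do not overlap, hence t_i < t_j. *)
    have : pi *+ i.+1 <= pi *+ j :> R by rewrite ler_wpMn2l // ltW // pi_gt0.
    by rewrite mulrSr; lra.
  have h1 := hsign _ jn; have h2 := hsign _ (ltnW jn).
  have : 0 < ((-1) ^+ j.+1 * h.[cos (t j.+1)]) * ((-1) ^+ j * h.[cos (t j)]).
    by rewrite nmulr_rgt0.
  by rewrite mulrACA exprS mulN1r mulNr -expr2 sqrr_sign mulN1r oppr_gt0.
by have := hsign 0 (leq0n n); rewrite h0 horner0 mulr0 ltxx.
Qed.

End PositiveParameter.

(** * Admissible polynomials and both signs of a *)

Lemma supnorm_le1P (R : realType) (p : {poly R[i]}) :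
  supnorm p <= 1 <-> forall x : R, -1 <= x <= 1 -> Normc.normc p.[x%:C] <= 1.
Proof.
have [[x xI <-] ub_p] := supnorm_is_max p; split=> [p1 y y1|]; last first.
  by apply; rewrite /= in_itv /= in xI.
by apply: le_trans p1; apply: ub_p; exists y; rewrite //= in_itv.
Qed.

(** The interval [-1,1] is symmetric, so p(-z) is admissible with p; this exchanges ai and -ai and
    reduces a < 0 to a > 0. *)
Lemma admissible_comp_oppX (R : realType) n (p : {poly R[i]}) :
  admissible n p -> admissible n (p \Po - 'X).
Proof.
case=> szp /supnorm_le1P p1; split.
  by rewrite /deg_le size_comp_poly2 // size_polyN size_polyX.
apply/supnorm_le1P => x x1; rewrite horner_comp !hornerE -rmorphN; apply: p1; lra.
Qed.

Lemma extremal_value_pos (R : realType) (a : R) (n : nat) : 0 < a -> (0 < n)%N ->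
  let M := Num.sqrt (a ^+ 2 + 1) * (a + Num.sqrt (a ^+ 2 + 1)) ^+ (n - 1) in
  [/\ admissible n (Q a n), Normc.normc (Q a n).[a%:C * 'i%C] = M
    & forall p, admissible n p -> Normc.normc p.[a%:C * 'i%C] <= M].
Proof.
move=> a0 n0 M; have QM := normc_Q_value a0 n0; split=> // [|p [szp /supnorm_le1P p1]].
  by split; [apply: size_Q | apply/supnorm_le1P => x; apply: normc_Q_le1].
by rewrite /M -QM; apply: extremal_bound.
Qed.

Unset Implicit Arguments.

Theorem proposition4p9 (R : realType) (a : R) (ha : a != 0)
    (n : nat) (hn : (1 <= n)%N) :
  let M : R := Num.sqrt (a ^+ 2 + 1)
             * (`|a| + Num.sqrt (a ^+ 2 + 1)) ^+ (n - 1)%N in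
  is_max [set Normc.normc p.[a%:C * 'i%C] | p in @admissible R n] M
  /\ (0 < a ->
      admissible n (Q a n) /\ Normc.normc (Q a n).[a%:C * 'i%C] = M).
Proof.
have [a0|a0|a0] := ltgtP 0 a; last by rewrite -a0 eqxx in ha.
  have [Qadm QM pM] := extremal_value_pos a0 hn; rewrite /= gtr0_norm //; split=> //.
  by split; [exists (Q a n) | move=> _ [p padm <-]; apply: pM].
have Na0 : 0 < - a by rewrite oppr_gt0.
have [Qadm QM pM] := extremal_value_pos Na0 hn.
rewrite sqrrN in QM pM; rewrite /= ltr0_norm //; split=> //.
have reflect_i (p : {poly R[i]}) : (p \Po - 'X).[a%:C * 'i%C] = p.[(- a)%:C * 'i%C].
  by rewrite horner_comp hornerN hornerX rmorphN mulNr.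
have reflect_Ni (p : {poly R[i]}) : (p \Po - 'X).[(- a)%:C * 'i%C] = p.[a%:C * 'i%C].
  by rewrite horner_comp hornerN hornerX rmorphN mulNr opprK.
split.
  (* For a < 0 the maximum is attained by the reflection of the extremal polynomial for -a. *)
  exists (Q (- a) n \Po - 'X); first exact: admissible_comp_oppX.
  by rewrite reflect_i.
by move=> _ [p padm <-]; rewrite -reflect_Ni; apply/pM/admissible_comp_oppX.
Qed.
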